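(* Up to dilations and rigid motions, the unique triangle in Behrend-bisecting position is the isosceles triangle whose different angle (the angle between its two equal sides) equals $\arccos\left(\sqrt{2/3}\right)$. That is, a non-degenerate triangle $K\subset\mathbb{R}^2$ is in Behrend-bisecting position if and only if it is an isosceles triangle whose angle between the two equal sides is $\arccos(\sqrt{2/3})$.
   Context: $\mathcal{K}^2$ is the family of planar convex bodies (compact convex subsets of $\mathbb{R}^2$) with non-empty interior. For a compact set $S\subset\mathbb{R}^2$, $\mathrm{A}(S)$ is its area (2-dimensional Lebesgue measure) and $\mathrm{D}(S)$ its diameter (largest Euclidean distance between two points of $S$). A bisection of $K\in\mathcal{K}^2$ is a pair of closed sets $(K_1,K_2)$ such that (i) $K=K_1\cup K_2$, and (ii) $K_1\cap K_2=l([-1,1])$, where $l:[-1,1]\to K$ is an injective continuous curve whose endpoints $l(-1),l(1)$ are the only points of the curve lying in the boundary of $K$. $\mathcal{B}(K)$ is the set of all bisections of $K$, and $\mathrm{D}_B(K)=\inf_{(K_1,K_2)\in\mathcal{B}(K)}\max\{\mathrm{D}(K_1),\mathrm{D}(K_2)\}$. A set $K\in\mathcal{K}^2$ is in Behrend-bisecting position if $$\frac{\mathrm{A}(K)}{\mathrm{D}_B(K)^2}=\sup_{\phi}\frac{\mathrm{A}(\phi(K))}{\mathrm{D}_B(\phi(K))^2},$$ where $\phi$ ranges over all nonsingular affine maps $\phi:\mathbb{R}^2\to\mathbb{R}^2$. *)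

(* Defs.v *)
From HB Require Import structures.
From mathcomp Require Import all_boot all_order all_algebra.
From mathcomp Require Import all_classical all_reals all_analysis.

Set Implicit Arguments.
Unset Strict Implicit.
Unset Printing Implicit Defensive.

Import Order.TTheory GRing.Theory Num.Theory.
Import numFieldNormedType.Exports.

Local Open Scope classical_set_scope.
Local Open Scope ring_scope.

(* [R^o] gives the product its [lmodType R] structure.  The library norm and
   balls of this product are those of the sup norm: they are used only through
   the topology, which is the usual one; all lengths go through [edist]. *)
Definition plane (R : realType) := (R^o * R^o)%type.

Section PlaneGeometry.
Variable R : realType.
Local Notation plane := (plane R).
Implicit Types (p q r : plane) (S K : set plane).

Definition dotp p q : R := p.1 * q.1 + p.2 * q.2.

Definition edist p q : R := Num.sqrt (dotp (p - q) (p - q)).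

Definition area S : \bar R :=
  (@lebesgue_measure R \x @lebesgue_measure R)%E (S : set (R * R)).

(* The real supremum, hence 0 on empty and on unbounded sets. *)
Definition diam S : R := sup [set edist pq.1 pq.2 | pq in S `*` S].

Definition boundary S : set plane := closure S `\` interior S.

Definition convex_body K : Prop :=
  [/\ convex_set K, compact K & interior K !=set0].

(* That the curve stays in K follows from its image being K1 `&` K2. *)
Definition bisections K : set (set plane * set plane) :=
  [set P | [/\ closed P.1, closed P.2, K = P.1 `|` P.2 &
    exists l : R -> plane,
      [/\ {within `[-1, 1], continuous l},
          {in `[-1, 1] &, injective l},
          P.1 `&` P.2 = l @` `[-1, 1] &
          forall t : R, t \in `[-1, 1] ->
            (boundary K (l t) <-> t = -1 \/ t = 1)]]].

Definition diamB K : R :=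
  inf [set Num.max (diam P.1) (diam P.2) | P in bisections K].

Definition affine_map (M : 'M[R]_2) (b : plane) p : plane :=
  (M 0 0 * p.1 + M 0 1 * p.2 + b.1, M 1 0 * p.1 + M 1 1 * p.2 + b.2).

Definition behrend_ratio K : R := fine (area K) / diamB K ^+ 2.

(* The supremum is taken in the extended reals, so that no boundedness of the
   set of ratios is presupposed. *)
Definition behrend_bisecting_position K : Prop :=
  convex_body K /\
  (behrend_ratio K)%:E =
  ereal_sup [set x : \bar R | exists M b,
    M \in unitmx /\ x = (behrend_ratio (affine_map M b @` K))%:E].

Definition noncollinear p q r : Prop :=
  (q - p).1 * (r - p).2 - (q - p).2 * (r - p).1 != 0.

Definition triangle_hull p q r : set plane :=
  [set x | exists a b c : R, [/\ 0 <= a, 0 <= b, 0 <= c, a + b + c = 1 &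
    x = a *: p + b *: q + c *: r]].

Definition is_triangle K : Prop :=
  exists p q r, noncollinear p q r /\ K = triangle_hull p q r.

(* The angle at the vertex p. *)
Definition angle p q r : R :=
  acos (dotp (q - p) (r - p) / (edist q p * edist r p)).

Definition isosceles_with_angle (alpha : R) K : Prop :=
  exists p q r, [/\ noncollinear p q r, K = triangle_hull p q r,
    edist q p = edist r p & angle p q r = alpha].

End PlaneGeometry.

(* Main.v *)
(* Let a triangle have sides u, v at P, let d = det(u, v), and let D be the square
   of the larger diameter of the two pieces of a bisection.  A piece containing
   all vertices forces D >= |d|; otherwise let P be the vertex separated from the
   two others.  By connectedness a point P + s u of the side along u lies in both
   pieces, so D >= s^2 |u|^2 and D >= |s u - v|^2.  The convex combination of
   these bounds with weights 1/4 and 3/4, minimised over s, gives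
   16 |u|^2 D >= 3 |u|^2 |v|^2 + 9 d^2, and likewise with u and v exchanged.  With
   AM-GM this yields D >= (3 sqrt 3 / 8) |d|, with equality only when |u| = |v| and
   |u|^2 |v|^2 = 3 d^2; if u.v <= 0 the second bound and its mirror image even give
   D >= |v|^2, |u|^2, hence D >= |d|.  Equality is attained by the straight cut at
   distance |u| / (2 cos) from P on both equal sides.  All triangles are affinely
   equivalent, so those with equality are the ones in Behrend-bisecting position. *)
Require Import Defs.
From mathcomp Require Import all_boot all_order all_algebra.
From mathcomp Require Import all_classical all_reals all_analysis.
From mathcomp Require Import ring lra.

(* The libraries also define an [edist]. *)
Import Defs.

Set Implicit Arguments.
Unset Strict Implicit.
Unset Printing Implicit Defensive.

Import Order.TTheory GRing.Theory Num.Theory.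
Import numFieldNormedType.Exports.

Local Open Scope classical_set_scope.
Local Open Scope ring_scope.

(** * Area of affine images *)

Section Area.
Variable R : realType.
Notation mu := (@lebesgue_measure R).

Lemma measurable_affine (m k : R) :
  measurable_fun [set: measurableTypeR R] (fun y : R => m * y + k).
Proof.
by apply: measurable_realfun.measurable_funD => //;
  apply: measurable_realfun.measurable_funM.
Qed.

(** Uniqueness of Lebesgue measure: [|m|] times the pushforward is a measure that gives every
    half-open interval its length. *)
Lemma lebesgue_measure_affine_preimage (m k : R) (A : set R) : m != 0 ->
  measurable A ->
  (`|m|%:E * mu ((fun y : R => (m * y + k)%R) @^-1` A) = mu A)%E.
Proof.
move=> m0 mA.
have mf := measurable_affine m k.
pose nu := mscale (NngNum (normr_ge0 m))
  (pushforward mu (fun y : R => m * y + k : measurableTypeR R)).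
transitivity (nu mf A); first by [].
apply/esym/(@lebesgue_measure_unique R (nu mf)) => //= _ [[a b]] _ <-.
rewrite /nu /mscale /pushforward /=.
have [mgt|mlt|/eqP] := ltgtP 0 m; last by rewrite eq_sym (negbTE m0).
- rewrite [X in (_ * mu X)%E](_ : _ = `](a - k) / m, (b - k) / m]%classic); last first.
    apply/seteqP; split => y /=; rewrite !in_itv /= ltr_pdivrMr // ler_pdivlMr // =>
      /andP[y1 y2]; apply/andP; split; lra.
  rewrite !lebesgue_measure_itv /= !lte_fin ltr_pM2r ?invr_gt0 // ltrD2r.
  case: ifP => _; last by rewrite mule0.
  rewrite -!EFinD -EFinM gtr0_norm //; congr EFin; field; exact: m0.
(* For [m < 0] the preimage is closed on the other side, which does not change its length. *)
- rewrite [X in (_ * mu X)%E](_ : _ = `[(b - k) / m, (a - k) / m[%classic); last first.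
    apply/seteqP; split => y /=; rewrite !in_itv /= ltr_ndivlMr // ler_ndivrMr // =>
      /andP[y1 y2]; apply/andP; split; lra.
  rewrite !lebesgue_measure_itv /= !lte_fin ltr_nM2r ?invr_lt0 // ltrD2r.
  case: ifP => _; last by rewrite mule0.
  rewrite -!EFinD -EFinM ltr0_norm //; congr EFin; field; exact: m0.
Qed.

Lemma measurable_fst_snd_affine (a b c : R) :
  measurable_fun [set: (R * R)%type] (fun x : R * R => a * x.1 + b * x.2 + c).
Proof.
by do 2![apply: measurable_realfun.measurable_funD => //];
  apply: measurable_realfun.measurable_funM.
Qed.

(** [area] integrates over vertical sections; by uniqueness of the product measure the horizontal
    ones give the same value, as [area_shear1] requires. *)
Lemma area_ysectionE (S : set (R * R)) : measurable S ->
  area S = (\int[mu]_y mu (ysection S y))%E.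
Proof.
move=> mS; rewrite /area.
rewrite (@product_measure_unique _ _ _ _ _ mu mu (product_measure2 mu mu)) //.
by move=> A B mA mB /=; rewrite product_measure2E.
Qed.

(** The map preserves each vertical line and acts on it as a one-dimensional affine map of slope
    [m]; the sections are then integrated. *)
Lemma area_shear2 (k m c : R) (S : set (R * R)) : m != 0 -> measurable S ->
  (`|m|%:E * area ((fun p : R * R => (p.1, k * p.1 + m * p.2 + c)%R) @^-1` S) = area S)%E.
Proof.
move=> m0 mS; rewrite /area /product_measure1.
have mf : measurable_fun [set: (R * R)%type]
    (fun p : R * R => (p.1, k * p.1 + m * p.2 + c)).
  by apply: measurable_fun_pair => //; exact: measurable_fst_snd_affine.
rewrite -ge0_integralZl_EFin //=; last first.
  apply: measurable_fun_xsection; rewrite -[X in measurable X]setTI; exact: mf.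
apply: eq_integral => x _ /=.
rewrite -(@lebesgue_measure_affine_preimage m (k * x + c) (xsection S x)) //; last first.
  exact: measurable_xsection.
congr (_ * mu _)%E; apply/seteqP; split => y; rewrite /xsection /= !inE /=.
  by rewrite (_ : k * x + m * y + c = m * y + (k * x + c)) //; ring.
by rewrite (_ : k * x + m * y + c = m * y + (k * x + c)) //; ring.
Qed.

Lemma area_shear1 (k m c : R) (S : set (R * R)) : m != 0 -> measurable S ->
  (`|m|%:E * area ((fun p : R * R => (m * p.1 + k * p.2 + c, p.2)%R) @^-1` S) = area S)%E.
Proof.
move=> m0 mS.
have mf : measurable_fun [set: (R * R)%type]
    (fun p : R * R => (m * p.1 + k * p.2 + c, p.2)).
  by apply: measurable_fun_pair => //; exact: measurable_fst_snd_affine.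
have mfS : measurable ((fun p : R * R => (m * p.1 + k * p.2 + c, p.2)) @^-1` S).
  by rewrite -[X in measurable X]setTI; exact: mf.
rewrite !area_ysectionE // -ge0_integralZl_EFin //=; last first.
  exact: measurable_fun_ysection.
apply: eq_integral => y _ /=.
rewrite -(@lebesgue_measure_affine_preimage m (k * y + c) (ysection S y)) //; last first.
  exact: measurable_ysection.
by congr (_ * mu _)%E; apply/seteqP; split => x; rewrite /ysection /= !inE /= addrA.
Qed.

(** Triangular factorisation: a map changing only the first coordinate, with factor [a], followed by
    one changing only the second, with factor [(a * d - b * c) / a]. *)
Lemma area_affine_preimage_pivot (a b c d e f : R) (S : set (R * R)) : a != 0 ->
  a * d - b * c != 0 -> measurable S ->
  (`|a * d - b * c|%:E *
    area ((fun p : R * R => (a * p.1 + b * p.2 + e, c * p.1 + d * p.2 + f)%R) @^-1` S)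
   = area S)%E.
Proof.
move=> a0 D0 mS.
pose g (p : R * R) := (p.1, c / a * p.1 + (a * d - b * c) / a * p.2 + (f - c / a * e)).
have mg : measurable_fun [set: (R * R)%type] g.
  by apply: measurable_fun_pair => //; exact: measurable_fst_snd_affine.
have mgS : measurable (g @^-1` S) by rewrite -[X in measurable X]setTI; exact: mg.
have Da : (a * d - b * c) / a != 0 by rewrite mulf_neq0 // invr_neq0.
rewrite -(area_shear2 (c / a) (f - c / a * e) Da mS) -/g.
rewrite -(area_shear1 b e a0 mgS) muleA -EFinM -normrM divfK //.
congr (_ * area _)%E; apply/seteqP; split => -[x y]; rewrite /g /=.
  by congr (S (_, _)); field.
by congr (S (_, _)); field.
Qed.

Lemma area_affine_preimage (a b c d e f : R) (S : set (R * R)) :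
  a * d - b * c != 0 -> measurable S ->
  (`|a * d - b * c|%:E *
    area ((fun p : R * R => (a * p.1 + b * p.2 + e, c * p.1 + d * p.2 + f)%R) @^-1` S)
   = area S)%E.
Proof.
move=> D0 mS; have [a0|a0] := eqVneq a 0; last exact: area_affine_preimage_pivot.
have b0 : b != 0.
  by apply: contraNneq D0 => b0; rewrite a0 b0 !mul0r subr0.
pose g (p : R * R) := (a * p.1 + b * p.2 + e, c * p.1 + d * p.2 + f).
have mg : measurable_fun [set: (R * R)%type] g.
  by apply: measurable_fun_pair => //; exact: measurable_fst_snd_affine.
have mgS : measurable (g @^-1` S) by rewrite -[X in measurable X]setTI; exact: mg.
(* Composing with the shear [(x, y) -> (x, x + y)], of determinant 1, replaces the zero pivot [a] by
   [a + b = b]. *)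
rewrite -/g -(area_shear2 1 0 (oner_neq0 R) mgS) normr1 mul1e.
have := @area_affine_preimage_pivot (a + b) b (c + d) d e f S.
rewrite {1}a0 add0r => /(_ b0); have -> : (a + b) * d - b * (c + d) = a * d - b * c by ring.
move=> /(_ D0 mS) <-.
congr (_ * area _)%E; apply/seteqP; split => -[x y]; rewrite /g /=.
  by congr (S (_, _)); ring.
by congr (S (_, _)); ring.
Qed.

End Area.

(** * Triangles in barycentric coordinates *)

Section Hull.
Variable R : realType.
Implicit Types (p q r x y : plane R) (s t : R).

Definition cross p q : R := p.1 * q.2 - p.2 * q.1.

(** Cramer's rule for the coordinates of [x - p] in the basis [q - p], [r - p]: the barycentric
    coordinates of [x] at [q] and [r]. *)
Definition bary2 p q r x : R := cross (x - p) (r - p) / cross (q - p) (r - p).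
Definition bary3 p q r x : R := cross (q - p) (x - p) / cross (q - p) (r - p).

Definition comb p q r s t : plane R := p + s *: (q - p) + t *: (r - p).

Lemma plane_eq x y : x.1 = y.1 -> x.2 = y.2 -> x = y.
Proof. by case: x y => [? ?] [? ?] /= -> ->. Qed.

Lemma bary2_comb p q r s t : noncollinear p q r ->
  bary2 p q r (comb p q r s t) = s.
Proof.
rewrite /noncollinear /bary2 /cross => d0.
rewrite [X in X / _](_ : _ = s * ((q - p).1 * (r - p).2 - (q - p).2 * (r - p).1)) ?mulfK //.
by rewrite /= /GRing.scale /=; ring.
Qed.

Lemma bary3_comb p q r s t : noncollinear p q r ->
  bary3 p q r (comb p q r s t) = t.
Proof.
rewrite /noncollinear /bary3 /cross => d0.
rewrite [X in X / _](_ : _ = t * ((q - p).1 * (r - p).2 - (q - p).2 * (r - p).1)) ?mulfK //.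
by rewrite /= /GRing.scale /=; ring.
Qed.

Lemma comb_bary p q r x : noncollinear p q r ->
  comb p q r (bary2 p q r x) (bary3 p q r x) = x.
Proof.
rewrite /noncollinear /= => d0.
by apply: plane_eq; rewrite /bary2 /bary3 /cross /= /GRing.scale /=; field.
Qed.

Lemma hullE p q r : noncollinear p q r -> triangle_hull p q r =
  [set x | [/\ 0 <= bary2 p q r x, 0 <= bary3 p q r x &
               bary2 p q r x + bary3 p q r x <= 1]].
Proof.
move=> d0; apply/seteqP; split => x /=.
  move=> [a [b [c [a0 b0 c0 abc ->]]]].
  have -> : a *: p + b *: q + c *: r = comb p q r b c.
    have -> : a = 1 - b - c by lra.
    by apply: plane_eq; rewrite /= /GRing.scale /=; ring.
  by rewrite bary2_comb // bary3_comb //; split => //; lra.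
move=> [b0 c0 bc].
exists (1 - bary2 p q r x - bary3 p q r x), (bary2 p q r x), (bary3 p q r x).
split=> //; [lra|lra|].
rewrite -{1}(comb_bary x d0).
by apply: plane_eq; rewrite /= /GRing.scale /=; ring.
Qed.

Lemma comb_hull p q r s t : 0 <= s -> 0 <= t -> s + t <= 1 ->
  triangle_hull p q r (comb p q r s t).
Proof.
move=> s0 t0 st; exists (1 - s - t), s, t; split=> //; [lra|lra|].
by apply: plane_eq; rewrite /= /GRing.scale /=; ring.
Qed.

Lemma hull_comb p q r x : triangle_hull p q r x ->
  exists s t, [/\ 0 <= s, 0 <= t, s + t <= 1 & x = comb p q r s t].
Proof.
move=> [a [b [c [a0 b0 c0 abc ->]]]]; exists b, c; split=> //; first lra.
have -> : a = 1 - b - c by lra.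
by apply: plane_eq; rewrite /= /GRing.scale /=; ring.
Qed.

(** * Closedness, measurability and area of triangles *)

Lemma continuous_affine (a b c : R) :
  continuous (fun x : plane R => a * x.1 + b * x.2 + c : R).
Proof.
move=> x; apply: cvgD; last exact: cvg_cst.
apply: cvgD; apply: cvgM; [exact: cvg_cst|exact: cvg_fst|exact: cvg_cst|exact: cvg_snd].
Qed.

Lemma bary2_affine p q r : exists a b c : R,
  bary2 p q r = (fun x => a * x.1 + b * x.2 + c).
Proof.
set d := cross (q - p) (r - p).
exists ((r - p).2 / d), (- (r - p).1 / d), ((p.2 * (r - p).1 - p.1 * (r - p).2) / d).
by apply/funext => x; rewrite /bary2 -/d /cross /=; ring.
Qed.

Lemma bary3_affine p q r : exists a b c : R,
  bary3 p q r = (fun x => a * x.1 + b * x.2 + c).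
Proof.
set d := cross (q - p) (r - p).
exists (- (q - p).2 / d), ((q - p).1 / d), ((p.1 * (q - p).2 - p.2 * (q - p).1) / d).
by apply/funext => x; rewrite /bary3 -/d /cross /=; ring.
Qed.

Lemma closed_affine_ge (a b c : R) :
  closed [set x : plane R | 0 <= a * x.1 + b * x.2 + c].
Proof.
apply: (@preimage_closed _ _ (fun x : plane R => a * x.1 + b * x.2 + c : R)
  [set y : R | 0 <= y]).
  by move=> x _; exact: continuous_affine.
exact: closed_ge.
Qed.

Lemma open_affine_gt (a b c : R) :
  open [set x : plane R | 0 < a * x.1 + b * x.2 + c].
Proof.
apply: (@open_comp _ _ (fun x : plane R => a * x.1 + b * x.2 + c : R)
  [set y : R | 0 < y]).
  by move=> x _; exact: continuous_affine.
exact: open_gt.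
Qed.

Lemma closed_hull p q r : noncollinear p q r -> closed (triangle_hull p q r).
Proof.
move=> d0; rewrite hullE //.
have [a [b [c e2]]] := bary2_affine p q r.
have [a' [b' [c' e3]]] := bary3_affine p q r.
have -> : [set x | [/\ 0 <= bary2 p q r x, 0 <= bary3 p q r x &
               bary2 p q r x + bary3 p q r x <= 1]] =
  [set x : plane R | 0 <= a * x.1 + b * x.2 + c] `&`
  [set x : plane R | 0 <= a' * x.1 + b' * x.2 + c'] `&`
  [set x : plane R | 0 <= (- a - a') * x.1 + (- b - b') * x.2 + (1 - c - c')].
  rewrite e2 e3; apply/seteqP; split => x /=.
    by move=> [h1 h2 h3]; split; [split|lra].
  by move=> [[h1 h2] h3]; split => //; lra.
by apply: closedI; [apply: closedI|]; exact: closed_affine_ge.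
Qed.

Lemma measurable_hull p q r : noncollinear p q r ->
  measurable (triangle_hull p q r : set (R * R)).
Proof.
move=> d0.
have mh (a b c : R) : measurable [set x : R * R | 0 <= a * x.1 + b * x.2 + c].
  have -> : [set x : R * R | 0 <= a * x.1 + b * x.2 + c] =
    (fun x : R * R => a * x.1 + b * x.2 + c) @^-1` `[0, +oo[.
    by apply/seteqP; split => x /=; rewrite in_itv /= andbT.
  by rewrite -[X in measurable X]setTI; apply: measurable_fst_snd_affine.
rewrite hullE //.
have [a [b [c e2]]] := bary2_affine p q r.
have [a' [b' [c' e3]]] := bary3_affine p q r.
have -> : [set x | [/\ 0 <= bary2 p q r x, 0 <= bary3 p q r x &
               bary2 p q r x + bary3 p q r x <= 1]] =
  [set x : R * R | 0 <= a * x.1 + b * x.2 + c] `&`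
  [set x : R * R | 0 <= a' * x.1 + b' * x.2 + c'] `&`
  [set x : R * R | 0 <= (- a - a') * x.1 + (- b - b') * x.2 + (1 - c - c')].
  rewrite e2 e3; apply/seteqP; split => x /=.
    by move=> [h1 h2 h3]; split; [split|lra].
  by move=> [[h1 h2] h3]; split => //; lra.
by apply: measurableI; [apply: measurableI|]; exact: mh.
Qed.

Definition std_triangle : set (R * R) :=
  [set x | [/\ 0 <= x.1, 0 <= x.2 & x.1 + x.2 <= 1]].

(** The standard triangle is the preimage of the hull under [(s, t) -> comb p q r s t], an affine
    map with determinant [cross (q - p) (r - p)]. *)
Lemma area_hull p q r : noncollinear p q r ->
  area (triangle_hull p q r) = (`|cross (q - p) (r - p)|%:E * area std_triangle)%E.
Proof.
move=> d0.
have D : (q - p).1 * (r - p).2 - (r - p).1 * (q - p).2 = cross (q - p) (r - p).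
  by rewrite /cross; ring.
have := @area_affine_preimage R (q - p).1 (r - p).1 (q - p).2 (r - p).2 p.1 p.2
  (triangle_hull p q r).
rewrite D => /(_ d0 (measurable_hull d0)) <-.
congr (_ * area _)%E; apply/seteqP; split => x /=.
  set y := (_, _).
  have -> : y = comb p q r x.1 x.2.
    by apply: plane_eq; rewrite /= /GRing.scale /=; ring.
  by rewrite hullE //= bary2_comb // bary3_comb.
set y := (_, _).
have -> : y = comb p q r x.1 x.2.
  by apply: plane_eq; rewrite /= /GRing.scale /=; ring.
by rewrite hullE //= bary2_comb // bary3_comb.
Qed.

Lemma noncollinear_std : noncollinear (0 : plane R) (1, 0) (0, 1).
Proof.
by rewrite /noncollinear /= !subr0 mulr1 mul0r subr0 oner_neq0.
Qed.

Lemma std_triangleE : std_triangle = triangle_hull (0 : plane R) (1, 0) (0, 1).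
Proof.
apply/seteqP; split => x.
  move=> [x1 x2 x12].
  have -> : x = comb 0 (1, 0) (0, 1) x.1 x.2.
    by apply: plane_eq; rewrite /= /GRing.scale /=; ring.
  exact: comb_hull.
by move=> /hull_comb[s [t [s0 t0 st ->]]]; split; rewrite /= /GRing.scale /=; lra.
Qed.

(* The value 1/2 is not needed: only ratios of areas matter. *)
Lemma area_std_triangle : exists2 c : R, 0 < c & area std_triangle = c%:E.
Proof.
have mT : measurable std_triangle.
  by rewrite std_triangleE; exact: (measurable_hull noncollinear_std).
have sq (a : R) : 0 < a ->
    area (`[0, a]%classic `*` `[0, a]%classic : set (R * R)) = (a * a)%:E.
  move=> a0; rewrite /area product_measure1E //= lebesgue_measure_itv /= lte_fin a0.
  by rewrite oppr0 adde0.
(* The triangle lies between squares of side 1/2 and 1, so its area is positive and finite. *)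
have lo : ((1 / 2 * (1 / 2))%:E <= area std_triangle)%E.
  rewrite -sq; last lra.
  apply: le_measure; rewrite ?inE //; first exact: measurableX.
  move=> x /= []; rewrite !in_itv /= => /andP[? ?] /andP[? ?]; split; lra.
have hi : (area std_triangle <= (1 * 1)%:E)%E.
  rewrite -sq; last lra.
  apply: le_measure; rewrite ?inE //; first exact: measurableX.
  move=> x /= [? ? ?]; rewrite !in_itv /=; split; apply/andP; split; lra.
have : area std_triangle \is a fin_num.
  rewrite ge0_fin_numE; first by apply: le_lt_trans hi _; rewrite ltry.
  by apply: le_trans lo; rewrite lee_fin; lra.
move=> /fineK E; exists (fine (area std_triangle)) => //.
by rewrite -lte_fin E; apply: lt_le_trans lo; rewrite lte_fin; lra.
Qed.

(** Used for compactness, and to make the supremum in [diam] a genuine one. *)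
Lemma hull_bounded p q r : exists B : R, forall x, triangle_hull p q r x ->
  `|x.1| <= B /\ `|x.2| <= B.
Proof.
exists (`|p.1| + `|q.1| + `|r.1| + `|p.2| + `|q.2| + `|r.2|).
move=> x [a [b [c [a0 b0 c0 abc ->]]]].
have bd (y1 y2 y3 : R) : `|a * y1 + b * y2 + c * y3| <= `|y1| + `|y2| + `|y3|.
  by do 2?[rewrite (le_trans (ler_normD _ _)) // lerD //];
    rewrite normrM ger0_norm //; apply: ler_piMl => //; lra.
have := bd p.1 q.1 r.1; have := bd p.2 q.2 r.2.
have n1 := normr_ge0 p.1; have n2 := normr_ge0 q.1; have n3 := normr_ge0 r.1.
have n4 := normr_ge0 p.2; have n5 := normr_ge0 q.2; have n6 := normr_ge0 r.2.
by rewrite /= /GRing.scale /= => h1 h2; split; lra.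
Qed.

(** * Triangles as convex bodies, with their interior and boundary *)

Lemma compact_hull p q r : noncollinear p q r -> compact (triangle_hull p q r).
Proof.
move=> d0; have [B hB] := hull_bounded p q r.
apply: (@subclosed_compact _ _ (`[- B, B]%classic `*` `[- B, B]%classic : set (plane R))).
- exact: closed_hull.
- by apply: compact_setX; exact: segment_compact.
- by move=> x /hB[]; rewrite !ler_norml => h1 h2; split; rewrite /= in_itv.
Qed.

Lemma convex_hull p q r : noncollinear p q r ->
  convex_set (triangle_hull p q r : set (convex_lmodType (plane R))).
Proof.
move=> d0 x y l; rewrite !inE.
move=> /hull_comb[s [t [s0 t0 st ->]]] /hull_comb[s' [t' [s'0 t'0 st' ->]]].
have l0 : 0 <= l%:num by [].
have l1 : l%:num <= 1 by [].
have -> : conv l (comb p q r s t : convex_lmodType (plane R)) (comb p q r s' t') =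
  comb p q r (l%:num * s + (1 - l%:num) * s') (l%:num * t + (1 - l%:num) * t').
  by apply: plane_eq; rewrite /= /GRing.scale /= /unstable.onem; ring.
apply: comb_hull; nra.
Qed.

Lemma continuous_affine_path (a b c d : R) :
  continuous (fun e : R => (e * a + b, e * c + d) : plane R).
Proof.
move=> e.
have ca (k l : R) : (fun e : R => e * k + l) @ e --> e * k + l.
  by apply: cvgD; [apply: cvgM; [exact: cvg_id|exact: cvg_cst]|exact: cvg_cst].
exact: (cvg_pair (F := nbhs e) (G := nbhs (e * a + b))
                 (H := nbhs (e * c + d)) (ca a b) (ca c d)).
Qed.

(** The strict inequalities define an open subset of the hull. Conversely, an interior point can be
    moved slightly towards each of the three sides without leaving the hull, so each inequality is
    strict. *)
Lemma interior_hull p q r s t : noncollinear p q r ->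
  interior (triangle_hull p q r) (comb p q r s t) <-> [/\ 0 < s, 0 < t & s + t < 1].
Proof.
move=> d0; split; last first.
  move=> [s0 t0 st].
  have [a [b [c e2]]] := bary2_affine p q r.
  have [a' [b' [c' e3]]] := bary3_affine p q r.
  rewrite /interior.
  apply: (@filterS _ _ _ (
  [set x : plane R | 0 < a * x.1 + b * x.2 + c] `&`
  [set x : plane R | 0 < a' * x.1 + b' * x.2 + c'] `&`
  [set x : plane R | 0 < (- a - a') * x.1 + (- b - b') * x.2 + (1 - c - c')])).
    by move=> x /= [[h1 h2] h3]; rewrite hullE // e2 e3 /=; split; lra.
  apply: open_nbhs_nbhs; split.
    by apply: openI; [apply: openI|]; exact: open_affine_gt.
  have E2 := bary2_comb s t d0; have E3 := bary3_comb s t d0.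
  move: E2 E3; rewrite e2 e3; move: (comb _ _ _ _ _) => x /= E2 E3.
  by split; [split|]; lra.
move=> h.
have line (ds dt : R) : exists2 e : R, 0 < e &
    triangle_hull p q r (comb p q r (s + e * ds) (t + e * dt)).
  pose f (e : R) : plane R := comb p q r (s + e * ds) (t + e * dt).
  have cf : continuous f.
    have fE : f = (fun e => (e * (ds * (q.1 - p.1) + dt * (r.1 - p.1)) + (comb p q r s t).1,
                             e * (ds * (q.2 - p.2) + dt * (r.2 - p.2)) + (comb p q r s t).2)).
      apply/funext => e; apply: plane_eq; rewrite /= /GRing.scale /=; ring.
    by rewrite fE; exact: continuous_affine_path.
  have f0 : f 0 = comb p q r s t by rewrite /f !mul0r !addr0.
  have : nbhs (f 0) (triangle_hull p q r) by rewrite f0.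
  move=> /(cf 0) /nbhs_ballP[e /= e0 he]; exists (e / 2); first lra.
  by apply: he; rewrite /ball /= sub0r normrN gtr0_norm; lra.
split.
- have [e e0] := line (-1) 0; rewrite hullE //= bary2_comb // => -[? ? ?]; lra.
- have [e e0] := line 0 (-1); rewrite hullE //= bary3_comb // => -[? ? ?]; lra.
- have [e e0] := line 1 0; rewrite hullE //= bary2_comb // bary3_comb // => -[? ? ?]; lra.
Qed.

Lemma convex_body_hull p q r : noncollinear p q r -> convex_body (triangle_hull p q r).
Proof.
move=> d0; split; [exact: convex_hull|exact: compact_hull|].
exists (comb p q r (1 / 3) (1 / 3)); apply/(interior_hull _ _ d0); split; lra.
Qed.

Lemma boundary_hull p q r s t : noncollinear p q r ->
  boundary (triangle_hull p q r) (comb p q r s t) <->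
  [/\ 0 <= s, 0 <= t & s + t <= 1] /\ [\/ s = 0, t = 0 | s + t = 1].
Proof.
move=> d0; rewrite /boundary.
have -> : closure (triangle_hull p q r) = triangle_hull p q r.
  by apply/esym/closure_id/closed_hull.
have inH : triangle_hull p q r (comb p q r s t) <-> [/\ 0 <= s, 0 <= t & s + t <= 1].
  by rewrite hullE //= bary2_comb // bary3_comb.
split.
  move=> [/inH[s0 t0 st] /(interior_hull s t d0) ni]; split => //.
  have [s_0|s_0] := eqVneq s 0; first exact: Or31.
  have [t_0|t_0] := eqVneq t 0; first exact: Or32.
  have [st_0|st_0] := eqVneq (s + t) 1; first exact: Or33.
  exfalso; apply: ni; split; rewrite lt_neqAle ?s0 ?t0 ?st ?andbT //.
    by rewrite eq_sym.
  by rewrite eq_sym.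
move=> [h1 h2]; split; first exact/inH.
by move=> /(interior_hull s t d0)[? ? ?]; case: h2; lra.
Qed.

End Hull.

(** * Lower bounds for bisections *)

Section Bisection.
Variable R : realType.
Implicit Types (p q r x y : plane R) (S K : set (plane R)) (s t D : R).

(** Squared distances keep the estimates polynomial. *)
Definition sqdist x y : R := dotp (x - y) (x - y).

Lemma sqdist_ge0 x y : 0 <= sqdist x y.
Proof. by rewrite addr_ge0 // -expr2 sqr_ge0. Qed.

Lemma sqr_edist x y : edist x y ^+ 2 = sqdist x y.
Proof. by rewrite sqr_sqrtr // sqdist_ge0. Qed.

Lemma diam_ge p q r S x y : S `<=` triangle_hull p q r -> S x -> S y ->
  sqdist x y <= diam S ^+ 2.
Proof.
move=> SK Sx Sy.
have [B hB] := hull_bounded p q r.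
have ub : has_ubound [set edist pq.1 pq.2 | pq in S `*` S].
  (* Coordinates in [[-B, B]] differ by at most [2B], and [(2B)^2 + (2B)^2 = 8B^2]. *)
  exists (Num.sqrt (8 * B ^+ 2)) => _ [[z1 z2] [/= /SK/hB[h1 h2] /SK/hB[h3 h4]] <-].
  rewrite ler_wsqrtr // /dotp /=.
  move: h1 h2 h3 h4; rewrite !ler_norml => /andP[? ?] /andP[? ?] /andP[? ?] /andP[? ?].
  nra.
have h : edist x y <= diam S by apply: ub_le_sup => //; exists (x, y).
by rewrite -sqr_edist ler_sqr // nnegrE ?sqrtr_ge0 // (le_trans _ h) // sqrtr_ge0.
Qed.

Lemma diam_ge0 S : 0 <= diam S.
Proof.
have [hs|hs] := pselect (has_sup [set edist pq.1 pq.2 | pq in S `*` S]);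
  last by rewrite /diam sup_out.
have [[e he] ub] := hs.
apply: le_trans (ub_le_sup ub he); case: he => z _ <-; exact: sqrtr_ge0.
Qed.

Lemma diam_le S d : 0 <= d -> (forall x y, S x -> S y -> sqdist x y <= d ^+ 2) ->
  diam S <= d.
Proof.
move=> d0 h.
have [->|/set0P[x Sx]] := eqVneq S set0.
  by rewrite /diam set0X image_set0 sup0.
apply: ge_sup; first by exists (edist x x), (x, x).
move=> _ [[y z] [/= Sy Sz] <-].
by rewrite -ler_sqr ?nnegrE ?sqrtr_ge0 // sqr_edist; exact: h.
Qed.

(** Were the pieces disjoint on the segment, the parameters of points in [K1] would form a nonempty
    open and closed subset of [[0, 1]], hence all of it, although [q] is in [K2]. *)
Lemma closed_cover_segment (K1 K2 : set (plane R)) p q :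
  closed K1 -> closed K2 -> K1 p -> K2 q ->
  (forall s, 0 <= s <= 1 -> (K1 `|` K2) (p + s *: (q - p))) ->
  exists2 s, 0 <= s <= 1 & (K1 `&` K2) (p + s *: (q - p)).
Proof.
move=> cK1 cK2 pK1 qK2 cov.
pose f s : plane R := p + s *: (q - p).
have cf : continuous f.
  have -> : f = (fun e => (e * (q.1 - p.1) + p.1, e * (q.2 - p.2) + p.2)).
    by apply/funext => e; apply: plane_eq; rewrite /= /GRing.scale /=; ring.
  exact: continuous_affine_path.
have f0 : f 0 = p by rewrite /f scale0r addr0.
have f1 : f 1 = q by rewrite /f scale1r addrC subrK.
apply: contrapT => nex.
have disj s : 0 <= s <= 1 -> K1 (f s) -> ~ K2 (f s).
  by move=> s01 h1 h2; apply: nex; exists s.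
have E : `[0, 1]%classic `&` (f @^-1` K1) = `[0, 1]%classic.
  apply: (@segment_connected R 0 1).
  - by exists 0; rewrite /= in_itv /= lexx ler01 f0.
  - exists (f @^-1` (~` K2)).
      by apply: open_comp; [move=> ? _; exact: cf|exact: closed_openC].
    apply/seteqP; split => s /= []; rewrite in_itv /= => s01.
      by move=> h; split => //; exact: disj.
    by move=> h; split => //; case: (cov s s01).
  - exists (f @^-1` K1) => //.
    by apply: preimage_closed => // ? _; exact: cf.
have : (`[0, 1]%classic `&` (f @^-1` K1)) 1 by rewrite E /= in_itv /= lexx ler01.
by move=> [_ h]; apply: (disj 1) => //; rewrite ?f1 // ler01 lexx.
Qed.

Definition dotat p q r : R := dotp (q - p) (r - p).

(* The first alternative covers a non-acute angle at [p], as well as a piece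
   containing all three vertices. *)
Definition isolation_bound p q r D : Prop :=
  let a := sqdist q p in let b := sqdist r p in
  let d := cross (q - p) (r - p) in
  `|d| <= D \/ [/\ 0 < dotat p q r, 3 * (a * b) + 9 * d ^+ 2 <= 16 * (a * D)
                  & 3 * (a * b) + 9 * d ^+ 2 <= 16 * (b * D)].

Lemma lagrange p q r :
  sqdist q p * sqdist r p = dotat p q r ^+ 2 + cross (q - p) (r - p) ^+ 2.
Proof. by rewrite /sqdist /dotat /dotp /cross; ring. Qed.

(** By Lagrange's identity the squared determinant is at most the product of the squared sides. *)
Lemma long_sides_bound p q r D : 
  sqdist q p <= D -> sqdist r p <= D -> `|cross (q - p) (r - p)| <= D.
Proof.
move=> h1 h2; have L := lagrange p q r.
have a0 := sqdist_ge0 q p; have b0 := sqdist_ge0 r p.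
have D0 : 0 <= D by lra.
rewrite -ler_sqr ?nnegrE ?normr_ge0 // real_normK ?num_real //.
have : sqdist q p * sqdist r p <= D * D by apply: ler_pM.
rewrite L; nra.
Qed.

Lemma isolated_side_bound p q r s D : 0 <= s ->
  sqdist (p + s *: (q - p)) p <= D -> sqdist (p + s *: (q - p)) r <= D ->
  (dotat p q r <= 0 -> sqdist r p <= D) /\
  3 * (sqdist q p * sqdist r p) + 9 * cross (q - p) (r - p) ^+ 2 <= 16 * (sqdist q p * D).
Proof.
move=> s0.
have -> : sqdist (p + s *: (q - p)) p = s ^+ 2 * sqdist q p.
  by rewrite /sqdist /dotp /= /GRing.scale /=; ring.
have -> : sqdist (p + s *: (q - p)) r =
    s ^+ 2 * sqdist q p - 2 * s * dotat p q r + sqdist r p.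
  by rewrite /sqdist /dotat /dotp /= /GRing.scale /=; ring.
have := lagrange p q r.
have := sqdist_ge0 q p; have := sqdist_ge0 r p.
move: (sqdist q p) (sqdist r p) (dotat p q r) (cross _ _) => a b w d a0 b0 L h1 h2.
split.
  move=> w0; have : 0 <= s * - w by rewrite mulr_ge0 // oppr_ge0.
  have : 0 <= s ^+ 2 * a by rewrite mulr_ge0 // sqr_ge0.
  lra.
(* Weights 1/4 and 3/4, scaled by 4. After multiplication by [a >= 0] (which is [b0]), the square
   below vanishes at the minimiser [s = 3w / (4a)], and Lagrange's identity eliminates [w]. *)
have k : s ^+ 2 * a + 3 * (s ^+ 2 * a - 2 * s * w + b) <= 4 * D by lra.
have := ler_wpM2l b0 k.
have := sqr_ge0 (4 * s * a - 3 * w).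
lra.
Qed.

Lemma isolated_vertex_bound (K1 K2 : set (plane R)) p q r :
  closed K1 -> closed K2 -> triangle_hull p q r = K1 `|` K2 ->
  K1 p -> K2 q -> K2 r ->
  isolation_bound p q r (Num.max (diam K1) (diam K2) ^+ 2).
Proof.
move=> c1 c2 E k1p k2q k2r.
set D := _ ^+ 2.
have s1 : K1 `<=` triangle_hull p q r by rewrite E; exact: subsetUl.
have s2 : K2 `<=` triangle_hull p q r by rewrite E; exact: subsetUr.
have [D1 D2] : diam K1 ^+ 2 <= D /\ diam K2 ^+ 2 <= D.
  by rewrite !ler_sqr ?nnegrE ?le_max ?diam_ge0 ?lexx ?orbT.
have covq s : 0 <= s <= 1 -> (K1 `|` K2) (p + s *: (q - p)).
  move=> /andP[s0 s1']; rewrite -E.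
  have -> : p + s *: (q - p) = comb p q r s 0 by rewrite /comb scale0r addr0.
  by apply: comb_hull; lra.
have covr s : 0 <= s <= 1 -> (K1 `|` K2) (p + s *: (r - p)).
  move=> /andP[s0 s1']; rewrite -E.
  have -> : p + s *: (r - p) = comb p q r 0 s by rewrite /comb scale0r addr0.
  by apply: comb_hull; lra.
have [s /andP[s0 _] [xs1 xs2]] := closed_cover_segment c1 c2 k1p k2q covq.
have [t /andP[t0 _] [xt1 xt2]] := closed_cover_segment c1 c2 k1p k2r covr.
have [wb Eb] := isolated_side_bound s0 (le_trans (diam_ge s1 xs1 k1p) D1)
                  (le_trans (diam_ge s2 xs2 k2r) D2).
have [wa Ea] := isolated_side_bound t0 (le_trans (diam_ge s1 xt1 k1p) D1)
                  (le_trans (diam_ge s2 xt2 k2q) D2).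
have dC : dotat p r q = dotat p q r by rewrite /dotat /dotp; ring.
have cC : cross (r - p) (q - p) ^+ 2 = cross (q - p) (r - p) ^+ 2 by rewrite /cross; ring.
rewrite dC in wa; rewrite cC [sqdist r p * sqdist q p]mulrC in Ea.
have [w0|w0] := leP (dotat p q r) 0; last by right.
by left; apply: long_sides_bound; [exact: wa|exact: wb].
Qed.

Lemma hull_cycle p q r : triangle_hull p q r = triangle_hull q r p.
Proof.
apply/seteqP; split => x [a [b [c [a0 b0 c0 abc ->]]]].
  exists b, c, a; split => //; first lra.
  by rewrite [RHS]addrC addrA.
exists c, a, b; split => //; first lra.
by rewrite -[RHS]addrA [RHS]addrC.
Qed.

Lemma cross_cycle p q r : cross (r - q) (p - q) = cross (q - p) (r - p).
Proof. by rewrite /cross /=; ring. Qed.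

Lemma noncollinear_cycle p q r : noncollinear p q r -> noncollinear q r p.
Proof.
by move=> d0; rewrite /noncollinear -[X in X != 0]/(cross (r - q) (p - q)) cross_cycle.
Qed.

Lemma bisection_bound p q r P : bisections (triangle_hull p q r) P ->
  let D := Num.max (diam P.1) (diam P.2) ^+ 2 in
  [\/ isolation_bound p q r D, isolation_bound q r p D | isolation_bound r p q D].
Proof.
case: P => K1 K2 [/= c1 c2 E _].
wlog k1p : K1 K2 c1 c2 E / K1 p.
  move=> wl.
  have : (K1 `|` K2) p.
    rewrite -E; exists 1, 0, 0; split => //; first lra.
    by rewrite !scale0r scale1r !addr0.
  case=> [k1p|k2p]; first exact: wl.
  by rewrite maxC; apply: wl => //; rewrite setUC.
have hq : (K1 `|` K2) q.
  rewrite -E; exists 0, 1, 0; split => //; first lra.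
  by rewrite !scale0r scale1r add0r addr0.
have hr : (K1 `|` K2) r.
  rewrite -E; exists 0, 0, 1; split => //; first lra.
  by rewrite !scale0r scale1r !add0r.
have E' : triangle_hull q r p = K2 `|` K1 by rewrite -hull_cycle setUC.
have E'' : triangle_hull r p q = K2 `|` K1 by rewrite -hull_cycle.
(* With [p] in [K1], either all vertices lie in [K1], or exactly one of [q], [r], [p] is separated
   from the other two. *)
case: hr => [k1r|k2r]; case: hq => [k1q|k2q].
- have s1 : K1 `<=` triangle_hull p q r by rewrite E; exact: subsetUl.
  have bd x : K1 x -> sqdist x p <= Num.max (diam K1) (diam K2) ^+ 2.
    move=> k1x; apply: le_trans (diam_ge s1 k1x k1p) _.
    by rewrite ler_sqr ?nnegrE ?le_max ?diam_ge0 ?lexx ?orbT.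
  by apply: Or31; left; apply: long_sides_bound; exact: bd.
- by apply: Or32; rewrite maxC; apply: isolated_vertex_bound.
- by apply: Or33; rewrite maxC; apply: isolated_vertex_bound.
- by apply: Or31; apply: isolated_vertex_bound.
Qed.

End Bisection.

(** * The extremal triangle *)

Section Extremal.
Variable R : realType.
Implicit Types (p q r x y : plane R) (D : R).

(** The sharp lower bound for the squared bisecting diameter of a triangle divided by twice its
    area. *)
Definition kappa : R := 3 * Num.sqrt 3 / 8.

Lemma kappa_gt0 : 0 < kappa.
Proof. by rewrite divr_gt0 // mulr_gt0 // sqrtr_gt0. Qed.

Lemma sqr_kappa : kappa ^+ 2 = 27 / 64.
Proof.
rewrite /kappa; have := @sqr_sqrtr R 3; move: (Num.sqrt 3) => z /(_ (ler0n _ _)) z2.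
have -> : (3 * z / 8) ^+ 2 = 9 / 64 * z ^+ 2 by field.
by rewrite z2; field.
Qed.

Lemma kappa_le1 : kappa <= 1.
Proof. by rewrite -ler_sqr ?nnegrE ?ler01 ?ltW ?kappa_gt0 // sqr_kappa; lra. Qed.

Definition cos_extremal : R := Num.sqrt (2 / 3).

Lemma cos_extremal_ge0 : 0 <= cos_extremal. Proof. exact: sqrtr_ge0. Qed.

Lemma sqr_cos_extremal : cos_extremal ^+ 2 = 2 / 3.
Proof. by rewrite sqr_sqrtr //; lra. Qed.

(** The lower bound amounts to [2 * (1 - cos_extremal) <= 3 / 8]: the base of the extremal triangle
    does not exceed the diameter of the pieces. *)
Lemma cos_extremal_bounds : 13 / 16 <= cos_extremal <= 5 / 6.
Proof.
have c0 := cos_extremal_ge0.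
by apply/andP; split; rewrite -ler_sqr ?nnegrE // ?sqr_cos_extremal; lra.
Qed.

(** The angle condition freed of [acos] and of division; [isosceles_extremal] gives the
    equivalence. *)
Definition extremal_at p q r : Prop :=
  sqdist q p = sqdist r p /\ dotat p q r = cos_extremal * sqdist q p.

Lemma noncollinear_sides p q r : noncollinear p q r ->
  0 < sqdist q p /\ 0 < sqdist r p.
Proof.
move=> d0; have := lagrange p q r.
have a0 := sqdist_ge0 q p; have b0 := sqdist_ge0 r p.
have d2 : 0 < cross (q - p) (r - p) ^+ 2 by rewrite exprn_even_gt0.
have w2 := sqr_ge0 (dotat p q r) => L.
split; rewrite lt_neqAle ?a0 ?b0 andbT; apply/eqP => z;
  rewrite -z ?mul0r ?mulr0 in L; lra.
Qed.

(* AM-GM: [3ab + 9d^2 >= 2 sqrt(27 ab) |d|], with equality iff [ab = 3d^2]. *)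
Lemma isolation_bound_ge p q r D : noncollinear p q r -> 0 <= D ->
  isolation_bound p q r D -> kappa * `|cross (q - p) (r - p)| <= D.
Proof.
move=> d0 D0; have [a0 b0] := noncollinear_sides d0.
rewrite /isolation_bound /=.
case=> [h|[_ h1 h2]].
  by apply: le_trans h; apply: ler_piMl => //; exact: kappa_le1.
have kd0 : 0 <= kappa * `|cross (q - p) (r - p)| by rewrite mulr_ge0 // ltW // kappa_gt0.
rewrite -ler_sqr ?nnegrE // exprMn sqr_kappa real_normK ?num_real //.
move: (sqdist q p) (sqdist r p) (cross _ _) a0 b0 h1 h2 => a b d a0 b0 h1 h2.
have ab0 : 0 < a * b by rewrite mulr_gt0.
have E0 : 0 <= 3 * (a * b) + 9 * d ^+ 2 by have := sqr_ge0 d; lra.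
have := ler_pM E0 E0 h1 h2.
have -> : 16 * (a * D) * (16 * (b * D)) = (a * b) * (256 * D ^+ 2) by ring.
(* [(3ab + 9d^2)^2 = (3ab - 9d^2)^2 + 108 ab d^2], and [108 / 256 = 27 / 64] is the square of
   [kappa]. *)
have := sqr_ge0 (3 * (a * b) - 9 * d ^+ 2) => h3 h4.
have : (a * b) * (108 * d ^+ 2) <= (a * b) * (256 * D ^+ 2) by nra.
rewrite ler_pM2l //; lra.
Qed.

(** The bisecting diameter is an infimum, so a strict inequality for each bisection would not
    suffice: a margin uniform in [D] is required. It exists because a zero margin forces equality in
    AM-GM and in both side estimates. *)
Lemma isolation_bound_gap p q r : noncollinear p q r -> ~ extremal_at p q r ->
  exists2 m, kappa * `|cross (q - p) (r - p)| < m &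
    forall D, isolation_bound p q r D -> m <= D.
Proof.
move=> d0 nex; have [a0 b0] := noncollinear_sides d0.
have L := lagrange p q r.
have dn0 : 0 < `|cross (q - p) (r - p)| by rewrite normr_gt0.
have kd : kappa * `|cross (q - p) (r - p)| < `|cross (q - p) (r - p)|.
  rewrite gtr_pMl // -ltr_sqr ?nnegrE ?ler01 ?ltW ?kappa_gt0 // sqr_kappa; lra.
have [w0|w0] := leP (dotat p q r) 0.
  exists `|cross (q - p) (r - p)| => // D [//|[w1]]; lra.
pose E := 3 * (sqdist q p * sqdist r p) + 9 * cross (q - p) (r - p) ^+ 2.
pose m1 := E / (16 * sqdist q p); pose m2 := E / (16 * sqdist r p).
exists (Num.min `|cross (q - p) (r - p)| (Num.max m1 m2)); last first.
  move=> D [h|[_ h1 h2]]; first by rewrite ge_min h.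
  rewrite ge_min ge_max /m1 /m2 !ler_pdivrMr ?mulr_gt0 //.
  by apply/orP; right; apply/andP; split; rewrite /E; lra.
(* If both [m1] and [m2] were at most [kappa * |d|], the triangle would be extremal. *)
rewrite lt_min kd /=; rewrite ltNge; apply/negP; rewrite ge_max => /andP[].
rewrite /m1 /m2 !ler_pdivrMr ?mulr_gt0 // /E => h1 h2; apply: nex.
have k2 := sqr_kappa; have k0 := kappa_gt0.
have := @real_normK R (cross (q - p) (r - p)) (num_real _).
rewrite /extremal_at.
have c2 := sqr_cos_extremal; have c0 := cos_extremal_ge0.
move: (sqdist q p) (sqdist r p) (dotat p q r) (cross _ _) `|_| kappa cos_extremal
  a0 b0 w0 L h1 h2 dn0 k2 k0 c2 c0 {m1 m2 E d0 kd}
  => a b w d n k c a0 b0 w0 L h1 h2 n0 k2 k0 c2 c0 nd.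
rewrite -nd in h1 h2 L.
have ab0 : 0 < a * b by rewrite mulr_gt0.
have E0 : 0 <= 3 * (a * b) + 9 * n ^+ 2 by have := sqr_ge0 n; lra.
have := ler_pM E0 E0 h1 h2.
have -> : k * n * (16 * a) * (k * n * (16 * b)) =
    (k ^+ 2) * (256 * (a * b) * n ^+ 2) by ring.
rewrite k2 => h.
(* Equality case of AM-GM: the square must vanish, so [ab = 3n^2]. *)
have h3 : (3 * (a * b) - 9 * n ^+ 2) ^+ 2 <= 0 by lra.
have ab3 : a * b = 3 * n ^+ 2.
  have /eqP : (3 * (a * b) - 9 * n ^+ 2) ^+ 2 == 0 by rewrite eq_le h3 sqr_ge0.
  by move/eqP; rewrite sqrf_eq0 => /eqP; lra.
have h1' : 9 * n <= 8 * k * a by rewrite -(ler_pM2l n0); nra.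
have h2' : 9 * n <= 8 * k * b by rewrite -(ler_pM2l n0); nra.
(* Both [8ka] and [8kb] are at least [9n], while their product is [(9n)^2]. *)
have prod : (8 * k * a) * (8 * k * b) = (9 * n) * (9 * n).
  have -> : (8 * k * a) * (8 * k * b) = 64 * k ^+ 2 * (a * b) by ring.
  by rewrite k2 ab3; field.
have a9 : 8 * k * a = 9 * n.
  apply/eqP; rewrite eq_le h1' andbT.
  have n9 : 0 < 9 * n by lra.
  by rewrite -(ler_pM2r n9) -prod ler_pM2l // !mulr_gt0.
have b9 : 8 * k * b = 9 * n.
  apply/eqP; rewrite eq_le h2' andbT.
  have n9 : 0 < 9 * n by lra.
  by rewrite -(ler_pM2l n9) -prod ler_pM2r // !mulr_gt0.
have ab : a = b.
  by apply: (@mulfI _ (8 * k)); [rewrite mulf_neq0 // gt_eqF|rewrite a9 b9].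
split => //.
have ca0 : 0 <= c * a by rewrite mulr_ge0 // ltW.
(* With [a = b] and [a^2 = 3n^2], Lagrange's identity gives [w^2 = (2/3) a^2 = (c a)^2], and both
   [w] and [c a] are nonnegative. *)
apply/eqP; rewrite -(@eqrXn2 _ 2) // ?(ltW w0) //.
by rewrite exprMn c2; apply/eqP; rewrite -ab -expr2 in ab3 L; lra.
Qed.

(** * Distances within the two pieces of the straight cut *)

Lemma quadratic_le (A B C D t0 t1 t : R) : 0 <= A -> t0 <= t -> t <= t1 ->
  A * t0 ^+ 2 + B * t0 + C <= D -> A * t1 ^+ 2 + B * t1 + C <= D ->
  A * t ^+ 2 + B * t + C <= D.
Proof.
move=> A0 h0 h1 g0 g1.
have [<-//|nt] := eqVneq t0 t; have lt0 : t0 < t by rewrite lt_neqAle nt.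
have l01 : 0 < t1 - t0 by lra.
rewrite -(ler_pM2l l01).
have t0' : 0 <= t - t0 by lra.
have t1' : 0 <= t1 - t by lra.
(* Convexity: the chord exceeds the parabola by [A (t - t0) (t1 - t)], here multiplied by
   [t1 - t0]. *)
have := ler_wpM2l t0' g1; have := ler_wpM2l t1' g0.
have := mulr_ge0 A0 (mulr_ge0 (ltW l01) (mulr_ge0 t0' t1')).
lra.
Qed.

(* The squared length of [x *: u + y *: v] for unit vectors [u], [v] at the
   extremal angle. *)
Definition unit_form (x y : R) : R := x ^+ 2 + y ^+ 2 + 2 * cos_extremal * x * y.

Lemma sqdist_comb p q r s t s' t' : extremal_at p q r ->
  sqdist (comb p q r s t) (comb p q r s' t') =
  sqdist q p * unit_form (s - s') (t - t').
Proof.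
move=> [ab w].
have -> : sqdist (comb p q r s t) (comb p q r s' t') = (s - s') ^+ 2 * sqdist q p +
  (t - t') ^+ 2 * sqdist r p + 2 * (s - s') * (t - t') * dotat p q r.
  by rewrite /sqdist /dotat /dotp /= /GRing.scale /=; ring.
by rewrite -ab w /unit_form; ring.
Qed.

(** A convex function on the trapezoid is bounded by its values at the corners: first move along the
    line of constant [x + y] to the axes ([g3]), then along each axis ([g1], [g2]). *)
Lemma unit_form_trapezoid_corners (lo hi u v x y D : R) : 0 <= x -> 0 <= y ->
  lo <= x + y -> x + y <= hi ->
  unit_form (lo - u) (0 - v) <= D -> unit_form (hi - u) (0 - v) <= D ->
  unit_form (0 - u) (lo - v) <= D -> unit_form (0 - u) (hi - v) <= D ->
  unit_form (x - u) (y - v) <= D.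
Proof.
move=> x0 y0 hlo hhi; have /andP[c1 c2] := cos_extremal_bounds.
rewrite /unit_form; move: cos_extremal c1 c2 => c c1 c2 h1 h2 h3 h4.
have g1 := quadratic_le (B := - 2 * u - 2 * c * v)
  (C := u ^+ 2 + v ^+ 2 + 2 * c * u * v) (D := D) ler01 hlo hhi.
have g2 := quadratic_le (B := - 2 * v - 2 * c * u)
  (C := u ^+ 2 + v ^+ 2 + 2 * c * u * v) (D := D) ler01 hlo hhi.
have cc : 0 <= 2 - 2 * c by lra.
have xs : x <= x + y by lra.
have g3 := quadratic_le (B := - 2 * u - 2 * (x + y - v) + 2 * c * (x + y - v + u))
   (C := u ^+ 2 + (x + y - v) ^+ 2 - 2 * c * u * (x + y - v)) (D := D) cc x0 xs.
suff : (2 - 2 * c) * x ^+ 2 + (- 2 * u - 2 * (x + y - v) + 2 * c * (x + y - v + u)) * x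
   + (u ^+ 2 + (x + y - v) ^+ 2 - 2 * c * u * (x + y - v)) <= D by lra.
apply: g3.
  suff : 1 * (x + y) ^+ 2 + (- 2 * v - 2 * c * u) * (x + y) +
    (u ^+ 2 + v ^+ 2 + 2 * c * u * v) <= D by lra.
  by apply: g2; lra.
suff : 1 * (x + y) ^+ 2 + (- 2 * u - 2 * c * v) * (x + y) +
    (u ^+ 2 + v ^+ 2 + 2 * c * u * v) <= D by lra.
by apply: g1; lra.
Qed.

(** Reduction to corners in each of the two points leaves the distances between corners: the legs,
    the diagonals and the two parallel sides. *)
Lemma unit_form_trapezoid (lo hi x y u v D : R) :
  0 <= x -> 0 <= y -> lo <= x + y -> x + y <= hi ->
  0 <= u -> 0 <= v -> lo <= u + v -> u + v <= hi -> 0 <= D ->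
  (hi - lo) ^+ 2 <= D -> lo ^+ 2 + hi ^+ 2 - 2 * cos_extremal * lo * hi <= D ->
  2 * (1 - cos_extremal) * lo ^+ 2 <= D -> 2 * (1 - cos_extremal) * hi ^+ 2 <= D ->
  unit_form (x - u) (y - v) <= D.
Proof.
move=> x0 y0 xy1 xy2 u0 v0 uv1 uv2 D0 h1 h2 h3 h4.
have sym a b a' b' : unit_form (a - a') (b - b') = unit_form (a' - a) (b' - b).
  by rewrite /unit_form; ring.
by apply: (unit_form_trapezoid_corners x0 y0 xy1 xy2); rewrite sym;
  apply: (unit_form_trapezoid_corners u0 v0 uv1 uv2); rewrite /unit_form; lra.
Qed.

(* [1 / (2 cos)], where the cut meets the equal sides of unit length. *)
Definition cut : R := 3 / 4 * cos_extremal.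

Lemma sqr_cut : cut ^+ 2 = 3 / 8.
Proof. by rewrite /cut exprMn sqr_cos_extremal; field. Qed.

Lemma cut_bounds : 0 < cut < 1.
Proof. by have := cos_extremal_bounds; rewrite /cut; lra. Qed.

(** The level lines of [bary2 + bary3] are parallel to the side from [q] to [r]. *)
Definition apex_piece p q r : set (plane R) :=
  [set z | triangle_hull p q r z /\ bary2 p q r z + bary3 p q r z <= cut].

Definition base_piece p q r : set (plane R) :=
  [set z | triangle_hull p q r z /\ cut <= bary2 p q r z + bary3 p q r z].

Lemma closed_apex_piece p q r : noncollinear p q r -> closed (apex_piece p q r).
Proof.
move=> d0; apply: closedI; first exact: closed_hull.
have [a [b [c e2]]] := bary2_affine p q r.
have [a' [b' [c' e3]]] := bary3_affine p q r.
rewrite e2 e3.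
have := @closed_affine_ge R (- a - a') (- b - b') (cut - c - c').
by congr closed; apply/funext => z /=; apply/propext; split; lra.
Qed.

Lemma closed_base_piece p q r : noncollinear p q r -> closed (base_piece p q r).
Proof.
move=> d0; apply: closedI; first exact: closed_hull.
have [a [b [c e2]]] := bary2_affine p q r.
have [a' [b' [c' e3]]] := bary3_affine p q r.
rewrite e2 e3.
have := @closed_affine_ge R (a + a') (b + b') (c + c' - cut).
by congr closed; apply/funext => z /=; apply/propext; split; lra.
Qed.

Lemma cut_bisection p q r : noncollinear p q r ->
  bisections (triangle_hull p q r) (apex_piece p q r, base_piece p q r).
Proof.
move=> d0; have /andP[s0 s1] := cut_bounds.
split => /=; [exact: closed_apex_piece|exact: closed_base_piece| |].
  apply/seteqP; split => z; last by move=> [[]|[]].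
  move=> hz; have [h|h] := leP (bary2 p q r z + bary3 p q r z) cut; first by left.
  by right; split => //; exact: ltW.
(* The straight segment from the side [pq] (at [t = -1]) to the side [pr] (at [t = 1]). *)
pose l (t : R) := comb p q r (cut * (1 - t) / 2) (cut * (1 + t) / 2).
have itv (t : R) : t \in `[-1, 1] -> -1 <= t /\ t <= 1.
  by rewrite in_itv /= => /andP[].
exists l; split.
- apply: continuous_subspaceT.
  have -> : l = (fun e => (e * (cut / 2 * (r.1 - q.1)) + (l 0).1,
                           e * (cut / 2 * (r.2 - q.2)) + (l 0).2)).
    by apply/funext => e; apply: plane_eq; rewrite /= /GRing.scale /=; field.
  exact: continuous_affine_path.
- move=> t t' _ _ /(congr1 (bary3 p q r)); rewrite /l !bary3_comb // => h.
  have : cut * (1 + t) = cut * (1 + t') by lra.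
  by move/mulfI => /(_ (lt0r_neq0 s0)); lra.
- apply/seteqP; split => z /=.
    move=> [[hz h1] [_ h2]].
    have s : bary2 p q r z + bary3 p q r z = cut by lra.
    move: hz; rewrite hullE //= => -[b2 b3 _].
    (* Obtained by solving [bary3 = cut * (1 + t) / 2] for [t]. *)
    exists (2 * bary3 p q r z / cut - 1).
      rewrite in_itv /=; apply/andP; split.
        by rewrite -subr_ge0 opprK subrK divr_ge0 ?(ltW s0) // mulr_ge0.
      by rewrite lerBlDr ler_pdivrMr //; lra.
    rewrite -[RHS](comb_bary z d0) /l; congr comb.
      have -> : bary2 p q r z = cut - bary3 p q r z by lra.
      by field; exact: lt0r_neq0.
    by field; exact: lt0r_neq0.
  move=> [t /itv[t1 t2] <-]; rewrite /l.
  have hl : triangle_hull p q r (l t) by apply: comb_hull; nra.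
  by split; split => //; rewrite bary2_comb // bary3_comb //; lra.
- move=> t /itv[t1 t2]; rewrite boundary_hull //; split.
    (* The third side is never met, since the coordinates along the curve sum to [cut < 1]. *)
    by move=> [_ []] h; [right|left|]; nra.
  case=> ->; split.
  + by split; nra.
  + by apply: Or32; lra.
  + by split; nra.
  + by apply: Or31; lra.
Qed.

Lemma hull_bary p q r z : noncollinear p q r -> triangle_hull p q r z ->
  [/\ 0 <= bary2 p q r z, 0 <= bary3 p q r z &
      bary2 p q r z + bary3 p q r z <= 1].
Proof. by move=> d0; rewrite hullE. Qed.

Lemma cut_diam p q r : noncollinear p q r -> extremal_at p q r ->
  Num.max (diam (apex_piece p q r)) (diam (base_piece p q r)) <=
  Num.sqrt (3 / 8 * sqdist q p).
Proof.
move=> d0 ex; have [a0 _] := noncollinear_sides d0.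
have /andP[s0 s1] := cut_bounds; have s2 := sqr_cut.
have /andP[c0 c1] := cos_extremal_bounds.
have c2 := sqr_cos_extremal.
have sqD : Num.sqrt (3 / 8 * sqdist q p) ^+ 2 = 3 / 8 * sqdist q p.
  by rewrite sqr_sqrtr // mulr_ge0 // ?ltW //; lra.
have bd x y :
    unit_form (bary2 p q r x - bary2 p q r y) (bary3 p q r x - bary3 p q r y) <= 3 / 8 ->
    sqdist x y <= Num.sqrt (3 / 8 * sqdist q p) ^+ 2.
  move=> h.
  have := sqdist_comb (bary2 p q r x) (bary3 p q r x)
                      (bary2 p q r y) (bary3 p q r y) ex.
  by rewrite !comb_bary // sqD => ->; rewrite mulrC ler_pM2r.
rewrite ge_max; apply/andP; split; apply: diam_le; rewrite ?sqrtr_ge0 //;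
  move=> x y [/(hull_bary d0)[x2 x3 xs] xc] [/(hull_bary d0)[y2 y3 ys] yc]; apply: bd.
  (* The apex piece is the degenerate trapezoid [lo = 0]; its equal sides have squared length
     [cut^2 = 3/8]. *)
  by apply: (@unit_form_trapezoid 0 cut); rewrite ?addr_ge0 //; nra.
apply: (@unit_form_trapezoid cut 1) => //; rewrite ?expr1n ?mulr1; try lra.
- nra.
(* The diagonal gives equality: [3/8 + 1 - 2 c (3/4 c) = 3/8], as [c^2 = 2/3]. *)
- rewrite -/cut /cut; move: s2; rewrite /cut; nra.
- rewrite s2; lra.
Qed.

(** The squared sine of the angle is 1/3, so [kappa^2 d^2 = (27/64) (a^2 / 3) = (3a/8)^2] with
    [a = sqdist q p]. *)
Lemma kappa_extremal p q r : extremal_at p q r ->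
  kappa * `|cross (q - p) (r - p)| = 3 / 8 * sqdist q p.
Proof.
move=> [ab w]; have L := lagrange p q r.
have a0 := sqdist_ge0 q p.
have k0 := kappa_gt0; have k2 := sqr_kappa; have c2 := sqr_cos_extremal.
have l0 : 0 <= kappa * `|cross (q - p) (r - p)| by rewrite mulr_ge0 // ltW.
have r0 : 0 <= 3 / 8 * sqdist q p by rewrite mulr_ge0 //; lra.
apply/eqP; rewrite -(@eqrXn2 _ 2) // [X in X == _]exprMn [X in _ == X]exprMn.
rewrite k2 real_normK ?num_real //.
by rewrite -ab w exprMn c2 in L; apply/eqP; lra.
Qed.

End Extremal.

(** * Affine maps and the area-diameter ratio *)

Lemma det_mx22 (R : comNzRingType) (M : 'M[R]_2) :
  \det M = M 0 0 * M 1 1 - M 0 1 * M 1 0.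
Proof.
have l0 : lift 0 0 = 1 :> 'I_2 by exact: val_inj.
have l1 : lift 1 0 = 0 :> 'I_2 by exact: val_inj.
rewrite (expand_det_row _ 0) !big_ord_recl big_ord0 /cofactor !det_mx11 !mxE /=.
by rewrite l0 l1 expr0 expr1; ring.
Qed.

Section Ratio.
Variable R : realType.
Implicit Types (p q r x y : plane R) (K : set (plane R)) (c m : R).

(** Nonemptiness excludes the default value 0 of [inf] on the empty set. *)
Lemma sqr_diamB_ge K m : bisections K !=set0 -> 0 <= m ->
  (forall P, bisections K P -> m <= Num.max (diam P.1) (diam P.2) ^+ 2) ->
  m <= diamB K ^+ 2.
Proof.
move=> [P0 bP0] m0 h.
have hs : Num.sqrt m <= diamB K.
  apply: lb_le_inf; first by exists (Num.max (diam P0.1) (diam P0.2)), P0.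
  move=> _ [P bP <-].
  have M0 : 0 <= Num.max (diam P.1) (diam P.2) by rewrite le_max diam_ge0.
  by rewrite -ler_sqr ?nnegrE ?sqrtr_ge0 // sqr_sqrtr //; exact: h.
by rewrite -{1}(sqr_sqrtr m0) ler_sqr // nnegrE ?sqrtr_ge0 // (le_trans _ hs) // sqrtr_ge0.
Qed.

Lemma diamB_le K P : bisections K P -> diamB K <= Num.max (diam P.1) (diam P.2).
Proof.
move=> bP; apply: ge_inf; last by exists P.
by exists 0 => _ [Q _ <-]; rewrite le_max diam_ge0.
Qed.

Lemma diamB_ge0 K : 0 <= diamB K.
Proof.
have [h|/nonemptyPn h] := pselect (bisections K !=set0); last first.
  by rewrite /diamB h image_set0 inf0.
have [P bP] := h.
apply: lb_le_inf; first by exists (Num.max (diam P.1) (diam P.2)), P.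
by move=> _ [Q _ <-]; rewrite le_max diam_ge0.
Qed.

Lemma diamB_kappa_ge p q r : noncollinear p q r ->
  bisections (triangle_hull p q r) !=set0 ->
  kappa R * `|cross (q - p) (r - p)| <= diamB (triangle_hull p q r) ^+ 2.
Proof.
move=> d0 h; have d1 := noncollinear_cycle d0; have d2 := noncollinear_cycle d1.
apply: sqr_diamB_ge => //; first by rewrite mulr_ge0 // ltW // kappa_gt0.
move=> P /bisection_bound /= [] b; first exact: isolation_bound_ge (sqr_ge0 _) b.
  by rewrite -cross_cycle; exact: isolation_bound_ge (sqr_ge0 _) b.
by rewrite -2!cross_cycle; exact: isolation_bound_ge (sqr_ge0 _) b.
Qed.

(** The ratio of a triangle with [diamB ^+ 2 = kappa * |d|]: the determinant cancels. *)
Definition max_ratio : R := fine (area (@std_triangle R)) / kappa R.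

Lemma max_ratio_gt0 : 0 < max_ratio.
Proof.
have [c c0 E] := area_std_triangle R.
by rewrite /max_ratio E divr_gt0 // kappa_gt0.
Qed.

Lemma behrend_ratio_hull p q r : noncollinear p q r ->
  behrend_ratio (triangle_hull p q r) =
  `|cross (q - p) (r - p)| * kappa R * max_ratio / diamB (triangle_hull p q r) ^+ 2.
Proof.
move=> d0; rewrite /behrend_ratio area_hull // /max_ratio.
have [c c0 ->] := area_std_triangle R.
rewrite -EFinM /= -[_ * kappa R * _]mulrA [kappa R * _]mulrC divfK //.
exact/lt0r_neq0/kappa_gt0.
Qed.

Lemma behrend_ratio_le p q r : noncollinear p q r ->
  behrend_ratio (triangle_hull p q r) <= max_ratio.
Proof.
move=> d0; rewrite behrend_ratio_hull //.
have M0 := max_ratio_gt0.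
have [h|/nonemptyPn h] := pselect (bisections (triangle_hull p q r) !=set0); last first.
  (* Without bisections [diamB] would be 0, and the quotient by zero is 0. *)
  by rewrite /diamB h image_set0 inf0 expr0n /= invr0 mulr0 ltW.
have kd0 : 0 < kappa R * `|cross (q - p) (r - p)|.
  by rewrite mulr_gt0 ?kappa_gt0 // normr_gt0.
have D0 := lt_le_trans kd0 (diamB_kappa_ge d0 h).
by rewrite ler_pdivrMr // [leRHS]mulrC ler_pM2r // mulrC diamB_kappa_ge // mulrC.
Qed.

Lemma behrend_ratio_lt p q r : noncollinear p q r ->
  ~ extremal_at p q r -> ~ extremal_at q r p -> ~ extremal_at r p q ->
  behrend_ratio (triangle_hull p q r) < max_ratio.
Proof.
move=> d0 n1 n2 n3; rewrite behrend_ratio_hull //.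
have M0 := max_ratio_gt0.
have [h|/nonemptyPn h] := pselect (bisections (triangle_hull p q r) !=set0); last first.
  by rewrite /diamB h image_set0 inf0 expr0n /= invr0 mulr0.
have kd0 : 0 < kappa R * `|cross (q - p) (r - p)|.
  by rewrite mulr_gt0 ?kappa_gt0 // normr_gt0.
have d1 := noncollinear_cycle d0; have d2 := noncollinear_cycle d1.
have [m1 m1d b1] := isolation_bound_gap d0 n1.
have [m2 m2d b2] := isolation_bound_gap d1 n2.
have [m3 m3d b3] := isolation_bound_gap d2 n3.
rewrite cross_cycle in m2d; rewrite 2!cross_cycle in m3d.
(* The least of the three margins holds for all bisections at once and so survives the infimum. *)
pose m := Num.min m1 (Num.min m2 m3).
have md : kappa R * `|cross (q - p) (r - p)| < m by rewrite !lt_min m1d m2d m3d.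
have hD : m <= diamB (triangle_hull p q r) ^+ 2.
  apply: sqr_diamB_ge => //; first by rewrite ltW // (lt_trans kd0).
  move=> P /bisection_bound /= []; rewrite /m !ge_min.
  - by move/b1 => ->.
  - by move/b2 => ->; rewrite orbT.
  - by move/b3 => ->; rewrite !orbT.
have hD' := lt_le_trans md hD.
have D0 := lt_trans kd0 hD'.
by rewrite ltr_pdivrMr // mulrC ltr_pM2l // mulrC.
Qed.

Lemma behrend_ratio_extremal p q r : noncollinear p q r -> extremal_at p q r ->
  max_ratio <= behrend_ratio (triangle_hull p q r).
Proof.
move=> d0 ex; rewrite behrend_ratio_hull //.
have M0 := max_ratio_gt0.
have bP := cut_bisection d0.
have kd0 : 0 < kappa R * `|cross (q - p) (r - p)|.
  by rewrite mulr_gt0 ?kappa_gt0 // normr_gt0.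
have hD : diamB (triangle_hull p q r) ^+ 2 <= kappa R * `|cross (q - p) (r - p)|.
  have := le_trans (diamB_le bP) (cut_diam d0 ex).
  rewrite -(kappa_extremal ex) => h.
  by rewrite -(sqr_sqrtr (ltW kd0)) ler_sqr ?nnegrE ?sqrtr_ge0 ?diamB_ge0.
have D0 : 0 < diamB (triangle_hull p q r) ^+ 2.
  rewrite (lt_le_trans kd0) //; apply: diamB_kappa_ge => //.
  by exists (apex_piece p q r, base_piece p q r).
by rewrite ler_pdivlMr // mulrC ler_pM2r // mulrC.
Qed.

(** * The angle condition and the affine equivalence of triangles *)

Lemma isosceles_extremal K :
  isosceles_with_angle (acos (Num.sqrt (2 / 3))) K <->
  exists p q r, [/\ noncollinear p q r, K = triangle_hull p q r & extremal_at p q r].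
Proof.
have c01 : Num.sqrt (2 / 3) \in `[(-1 : R), 1].
  have := cos_extremal_bounds R; rewrite /cos_extremal => /andP[h1 h2].
  by rewrite in_itv /=; apply/andP; split; lra.
have angleE p q r : sqdist q p = sqdist r p ->
    angle p q r = acos (dotat p q r / sqdist q p).
  move=> e; rewrite /angle /edist -[dotp (q - p) (q - p)]/(sqdist q p).
  by rewrite -[dotp (r - p) (r - p)]/(sqdist r p) -e -expr2 sqr_sqrtr // sqdist_ge0.
split=> -[p [q [r]]].
  move=> [d0 KE ed an]; exists p, q, r; split => //.
  have e : sqdist q p = sqdist r p by rewrite -!sqr_edist ed.
  have [a0 _] := noncollinear_sides d0.
  split => //; rewrite angleE // in an.
  (* Cauchy-Schwarz, from Lagrange's identity: the quotient lies where [cos] inverts [acos]. *)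
  have w01 : dotat p q r / sqdist q p \in `[(-1 : R), 1].
    rewrite in_itv /= -ler_norml -(expr_le1 (n := 2)) // real_normK ?num_real //.
    rewrite expr_div_n ler_pdivrMr ?exprn_gt0 // mul1r.
    have := lagrange p q r; have := sqr_ge0 (cross (q - p) (r - p)).
    by rewrite -e; lra.
  have := congr1 cos an; rewrite !acosK // /cos_extremal => <-.
  by rewrite divfK // lt0r_neq0.
move=> [d0 KE [e w]]; exists p, q, r; split => //.
  by rewrite /edist -[dotp (q - p) (q - p)]/(sqdist q p) e.
have [a0 _] := noncollinear_sides d0.
by rewrite angleE // w mulfK // lt0r_neq0.
Qed.

Lemma affine_map_hull (M : 'M[R]_2) b p q r :
  affine_map M b @` triangle_hull p q r =
  triangle_hull (affine_map M b p) (affine_map M b q) (affine_map M b r).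
Proof.
have comm s t : affine_map M b (comb p q r s t) =
    comb (affine_map M b p) (affine_map M b q) (affine_map M b r) s t.
  by apply: plane_eq; rewrite /= /GRing.scale /=; ring.
apply/seteqP; split => x.
  move=> [_ /hull_comb[s [t [s0 t0 st ->]]] <-]; rewrite comm; exact: comb_hull.
move=> /hull_comb[s [t [s0 t0 st ->]]]; exists (comb p q r s t) => //; exact: comb_hull.
Qed.

Lemma cross_affine_map (M : 'M[R]_2) b p q r :
  cross (affine_map M b q - affine_map M b p) (affine_map M b r - affine_map M b p) =
  \det M * cross (q - p) (r - p).
Proof. by rewrite det_mx22 /cross /=; ring. Qed.

Lemma noncollinear_affine_map (M : 'M[R]_2) b p q r : M \in unitmx ->
  noncollinear p q r ->
  noncollinear (affine_map M b p) (affine_map M b q) (affine_map M b r).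
Proof.
rewrite unitmxE unitfE => M0 d0.
rewrite /noncollinear -[X in X != 0]/(cross (_ - _) (_ - _)) cross_affine_map.
exact: mulf_neq0.
Qed.

Lemma affine_map_transitive p q r p' q' r' :
  noncollinear p q r -> noncollinear p' q' r' ->
  exists2 M : 'M[R]_2, M \in unitmx & exists b,
    [/\ affine_map M b p = p', affine_map M b q = q' & affine_map M b r = r'].
Proof.
move=> d0 d0'; set d := cross (q - p) (r - p).
have dn0 : d != 0 by [].
(* The row [(u, v)] times the inverse of the matrix with columns [q - p] and [r - p]; the
   translation [b] then sends [p] to [p']. *)
pose entry (u v : R) (j : 'I_2) : R :=
  (if j == 0 then u * (r - p).2 - v * (q - p).2 else v * (q - p).1 - u * (r - p).1) / d.
pose M : 'M[R]_2 := \matrix_(i, j)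
  if i == 0 then entry (q' - p').1 (r' - p').1 j else entry (q' - p').2 (r' - p').2 j.
pose b : plane R := (p'.1 - (M 0 0 * p.1 + M 0 1 * p.2),
                     p'.2 - (M 1 0 * p.1 + M 1 1 * p.2)).
have E : [/\ affine_map M b p = p', affine_map M b q = q' & affine_map M b r = r'].
  move: dn0; rewrite /d /cross /= => dn0.
  by split; apply: plane_eq;
    rewrite /b /affine_map /= !mxE /= /entry /= /d /cross /=; field.
exists M; last by exists b.
rewrite unitmxE unitfE; have := cross_affine_map M b p q r.
have [-> -> ->] := E => h; apply: contraNneq d0' => M0.
by rewrite -[X in X == 0]/(cross (q' - p') (r' - p')) h M0 mul0r.
Qed.

Lemma extremal_triangle_exists :
  exists p q r, noncollinear p q r /\ extremal_at p q r.
Proof.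
have c2 := sqr_cos_extremal R; pose s : R := Num.sqrt (1 / 3).
have s0 : 0 < s by rewrite sqrtr_gt0; lra.
have s2 : s ^+ 2 = 1 / 3 by rewrite sqr_sqrtr //; lra.
(* Two unit sides enclosing the extremal angle, with sine [s]. *)
exists (0 : plane R), (1, 0), (cos_extremal R, s); split.
  by rewrite /noncollinear /= !subr0 mul0r subr0 mul1r lt0r_neq0.
by rewrite /extremal_at /sqdist /dotat /dotp /=; split; lra.
Qed.

End Ratio.

Theorem proposition5p6 (R : realType) (K : set (plane R))
    (hK : is_triangle K) :
  behrend_bisecting_position K <->
  isosceles_with_angle (acos (Num.sqrt (2%:R / 3%:R))) K.
Proof.
rewrite isosceles_extremal; split.
  move=> [_ maxK]; have [p [q [r [d0 KE]]]] := hK.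
  (* If no vertex is extremal, the ratio of [K] is below [max_ratio]; but an extremal triangle is an
     affine image of [K], so maximality of [K] is contradicted. *)
  apply: contrapT => nex.
  have lt : behrend_ratio K < max_ratio R.
    have d1 := noncollinear_cycle d0; have d2 := noncollinear_cycle d1.
    rewrite KE; apply: behrend_ratio_lt => // ex; apply: nex.
    - by exists p, q, r.
    - by exists q, r, p; split=> //; rewrite -hull_cycle.
    - by exists r, p, q; split=> //; rewrite hull_cycle.
  have [p' [q' [r' [d0' ex]]]] := extremal_triangle_exists R.
  have [M Mu [b [bp bq br]]] := affine_map_transitive d0 d0'.
  have := behrend_ratio_extremal d0' ex; rewrite leNgt => /negP; apply.
  apply: le_lt_trans lt; rewrite -lee_fin maxK.
  apply: ereal_sup_ubound; exists M, b; split => //.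
  by rewrite KE affine_map_hull bp bq br.
move=> [p [q [r [d0 KE ex]]]]; split; first by rewrite KE; exact: convex_body_hull.
apply/eqP; rewrite eq_le; apply/andP; split.
  (* The identity map puts the ratio of [K] itself among those compared. *)
  apply: ereal_sup_ubound; exists 1%:M, 0; split; first exact: unitmx1.
  congr (behrend_ratio _)%:E; rewrite -[LHS]image_id; apply: eq_imagel => x _.
  by apply: plane_eq; rewrite /affine_map /= !mxE /= !mul1r !mul0r !addr0 ?add0r.
(* Every affine image is again a triangle, with ratio at most [max_ratio], which [K] reaches. *)
apply: ge_ereal_sup => _ [M [b [Mu ->]]]; rewrite lee_fin KE affine_map_hull.
apply: le_trans (behrend_ratio_extremal d0 ex).
exact/behrend_ratio_le/noncollinear_affine_map.
Qed.
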